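(* Let $n\ge 1$ and $\mu\in\mathbb{Z}^n$. For generic $q,t$, the support $\mathrm{supp}(E_\mu)\subseteq\mathbb{Z}^n$ of the non-symmetric Macdonald polynomial $E_\mu(x_1,\dots,x_n;q,t)$ is an M-convex set. In particular, $E_\mu$ has the saturated Newton polytope property: $\mathrm{conv}(\mathrm{supp}(E_\mu))\cap\mathbb{Z}^n=\mathrm{supp}(E_\mu)$.
   Context: **Diagrams and fillings.** For a weak composition $\mu=(\mu_1,\dots,\mu_n)\in\mathbb{Z}_{\ge0}^n$ let $dg'(\mu)=\{(i,j):1\le i\le n,\ 1\le j\le\mu_i\}$ ($i$ is the column, $j$ the row) and $\widehat{dg}(\mu)=dg'(\mu)\cup\{(i,0):1\le i\le n\}$. A filling is a map $\sigma:dg'(\mu)\to\{1,\dots,n\}$; its augmented filling $\widehat\sigma:\widehat{dg}(\mu)\to\{1,\dots,n\}$ extends $\sigma$ by $\widehat\sigma(i,0)=i$. Two distinct boxes attack each other if they are in the same row, or they are in consecutive rows and the box in the lower row is in a column strictly to the right of that of the box in the upper row. $\sigma$ is non-attacking if $\widehat\sigma(u)\ne\widehat\sigma(v)$ for all attacking pairs $u,v\in\widehat{dg}(\mu)$. Put $x^\sigma=\prod_{u\in dg'(\mu)}x_{\sigma(u)}$. **Statistics.** For $u=(i,j)\in dg'(\mu)$ let $d(u)=(i,j-1)$, $l(u)=\mu_i-j$, and $a(u)=\#\{(i',j)\in dg'(\mu):i'<i,\ \mu_{i'}\le\mu_i\}+\#\{(i',j-1)\in\widehat{dg}(\mu):i'>i,\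 \mu_{i'}<\mu_i\}$. Let $\mathrm{Des}(\widehat\sigma)=\{u\in dg'(\mu):\widehat\sigma(u)>\widehat\sigma(d(u))\}$. The reading order on $\widehat{dg}(\mu)$ goes row by row from top to bottom, and right to left within each row; $\mathrm{Inv}(\widehat\sigma)$ is the set of attacking pairs $u,v\in\widehat{dg}(\mu)$ with $u$ before $v$ in reading order and $\widehat\sigma(u)>\widehat\sigma(v)$. Set $\mathrm{maj}(\widehat\sigma)=\sum_{u\in\mathrm{Des}(\widehat\sigma)}(l(u)+1)$, $\mathrm{inv}(\widehat\sigma)=|\mathrm{Inv}(\widehat\sigma)|-|\{i<j:\mu_i\le\mu_j\}|-\sum_{u\in\mathrm{Des}(\widehat\sigma)}a(u)$, $\mathrm{coinv}(\widehat\sigma)=\sum_{u\in dg'(\mu)}a(u)-\mathrm{inv}(\widehat\sigma)$. **Non-symmetric Macdonald polynomials.** For $\mu\in\mathbb{Z}_{\ge0}^n$, $$E_\mu=\sum_{\sigma\ \text{non-attacking}}x^\sigma q^{\mathrm{maj}(\widehat\sigma)}t^{\mathrm{coinv}(\widehat\sigma)}\prod_{u\in dg'(\mu),\ \widehat\sigma(u)\ne\widehat\sigma(d(u))}\frac{1-t}{1-q^{l(u)+1}t^{a(u)+1}}\in\mathbb{Q}(q,t)[x_1,\dots,x_n].$$ For general $\mu\in\mathbb{Z}^n$ write $\mu=(m,\dots,m)+\mu'$ with $m\in\mathbb{Z}$, $\mu'\in\mathbb{Z}_{\ge0}^n$, and set $E_\mu=(x_1\cdots x_n)^mE_{\mu'}$.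 ''Generic $q,t$'' means $q,t$ are treated as indeterminates; any real choice $0<q,t<1$ may be used instead. **Support.** For a Laurent polynomial $f$, $\mathrm{supp}(f)=\{\alpha\in\mathbb{Z}^n: x^\alpha\text{ has nonzero coefficient in }f\}$. **M-convexity.** A polytope $P\subset\mathbb{R}^n$ is a generalized permutahedron if for every pair of adjacent vertices $\mathbf u,\mathbf v$ of $P$ there are $i,j\in[n]$ with $\mathbf u-\mathbf v\in\mathrm{span}(e_i-e_j)$. A set $S\subseteq\mathbb{Z}^n$ is M-convex if $S=P\cap\mathbb{Z}^n$ for some generalized permutahedron $P$ with all vertices in $\mathbb{Z}^n$. *)

(* Defs.v *)
From mathcomp Require Import all_boot all_order all_algebra.
From mathcomp Require Import finmap classical_sets reals.
From mathcomp.multinomials Require Export monalg.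

Set Implicit Arguments.
Unset Strict Implicit.
Unset Printing Implicit Defensive.

Import Order.TTheory GRing.Theory Num.Theory.
Local Open Scope ring_scope.

(* Rows and columns are 0-based inside ordinals: a column is an element of
   'I_n, [Tagged _ k : dg mu] is the box of column i in row k + 1, and
   [Tagged _ k : adg mu] is the box of column i in row k, so that the basement
   is row 0.  Entries {1, .., n} are likewise encoded by 'I_n; only their
   relative order matters. *)
Notation dg mu := {i & 'I_(mu i)}.
Notation adg mu := {i & 'I_(mu i).+1}.

Section Fillings.
Variables (n : nat) (mu : 'I_n -> nat).

Definition bcol (u : adg mu) : 'I_n := tag u.
Definition brow (u : adg mu) : nat := tagged u.

Definition box (u : dg mu) : adg mu :=
  Tagged (fun i => 'I_(mu i).+1) (lift ord0 (tagged u)).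

Definition below (u : dg mu) : adg mu :=
  Tagged (fun i => 'I_(mu i).+1) (widen_ord (leqnSn _) (tagged u)).

Definition filling := {ffun dg mu -> 'I_n}.

Definition aug (s : filling) (u : adg mu) : 'I_n :=
  if unlift ord0 (tagged u) is Some k
  then s (Tagged (fun i => 'I_(mu i)) k) else tag u.

Definition attack_down (u v : adg mu) : bool :=
  (brow u == (brow v).+1) && (bcol u < bcol v)%N.

Definition attack (u v : adg mu) : bool :=
  (u != v) && [|| brow u == brow v, attack_down u v | attack_down v u].

Definition nonattacking (s : filling) : bool :=
  [forall u, forall v, attack u v ==> (aug s u != aug s v)].

Definition leg (u : dg mu) : nat := (mu (tag u) - brow (box u))%N.

Definition arm (u : dg mu) : nat :=
  (#|[set v : dg mu | [&& brow (box v) == brow (box u),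
                          (tag v < tag u)%N & (mu (tag v) <= mu (tag u))%N]]|
   + #|[set v : adg mu | [&& brow v == (brow (box u)).-1,
                             (tag u < bcol v)%N & (mu (bcol v) < mu (tag u))%N]]|)%N.

Definition Des (s : filling) : {set dg mu} :=
  [set u | (aug s (below u) < aug s (box u))%N].

Definition reads_before (u v : adg mu) : bool :=
  (brow v < brow u)%N || ((brow u == brow v) && (bcol v < bcol u)%N).

Definition Inv (s : filling) : {set adg mu * adg mu} :=
  [set p | [&& attack p.1 p.2, reads_before p.1 p.2
             & (aug s p.2 < aug s p.1)%N]].

Definition maj (s : filling) : nat := (\sum_(u in Des s) (leg u).+1)%N.

Definition inv_stat (s : filling) : int :=
  #|Inv s|%:Z
  - #|[set p : 'I_n * 'I_n | (p.1 < p.2)%N && (mu p.1 <= mu p.2)%N]|%:Z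
  - (\sum_(u in Des s) arm u)%N%:Z.

Definition coinv (s : filling) : int := (\sum_(u : dg mu) arm u)%N%:Z - inv_stat s.

(* The exponent vector of x^s. *)
Definition content (s : filling) : 'rV[int]_n :=
  \sum_(u : dg mu) delta_mx 0 (s u).

Definition weight (F : fieldType) (q t : F) (s : filling) : F :=
  q ^+ maj s * t ^ coinv s *
  \prod_(u : dg mu | aug s (box u) != aug s (below u))
     ((1 - t) / (1 - q ^+ (leg u).+1 * t ^+ (arm u).+1)).

End Fillings.

(* Laurent polynomials in n variables over F, as finitely supported functions
   on Z^n; [<< c *g a >>] is the term c x^a.  The product of monalg is not
   available here, since it requires exponents to have no inverses. *)
Notation laurent F n := {malg F['rV[int]_n]}.

(* x^a * f *)
Definition monomial_mul (F : fieldType) (n : nat) (a : 'rV[int]_n)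
    (f : laurent F n) : laurent F n :=
  \sum_(b <- msupp f) << f@_b *g a + b >>.

Definition supp (F : fieldType) (n : nat) (f : laurent F n) :
  set 'rV[int]_n := [set a | f@_a != 0]%classic.

Definition macdonald_nonneg (F : fieldType) (q t : F) (n : nat)
    (mu : 'I_n -> nat) : laurent F n :=
  \sum_(s : filling mu | nonattacking s) << weight q t s *g content s >>.

(* E_mu computed from the decomposition mu = (m, .., m) + mu'; this is
   meaningful when m <= mu_i for all i, so that mu' is nonnegative. *)
Definition macdonald (F : fieldType) (q t : F) (n : nat) (mu : 'rV[int]_n)
    (m : int) : laurent F n :=
  monomial_mul (const_mx m)
    (macdonald_nonneg q t (fun i => `|(mu 0 i - m)%R|%N)).

(* Q(q,t), as the fraction field of Q[q][t]. *)
Notation Qqt := {fraction {poly {poly rat}}}.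
Definition q_ind : Qqt := tofrac ('X%:P : {poly {poly rat}}).
Definition t_ind : Qqt := tofrac ('X : {poly {poly rat}}).

Section Polytopes.
Local Open Scope classical_set_scope.
Variables (R : realType) (n : nat).
Implicit Types (P F : set 'rV[R]_n) (u v c : 'rV[R]_n).

Definition conv (X : set 'rV[R]_n) : set 'rV[R]_n :=
  [set x | exists (k : nat) (p : 'I_k -> 'rV[R]_n) (w : 'I_k -> R),
     [/\ forall i, X (p i), forall i, 0 <= w i, \sum_(i < k) w i = 1
       & x = \sum_(i < k) w i *: p i]].

Definition polytope P : Prop :=
  exists s : seq 'rV[R]_n, P = conv [set` s].

Definition dot u v : R := \sum_(i < n) u 0 i * v 0 i.

(* Faces are maximizer sets of linear functionals; for a polytope these are all
   its nonempty faces. *)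
Definition face P F : Prop :=
  exists c, F = [set x | P x /\ forall y, P y -> dot c y <= dot c x].

Definition vertex P v : Prop := face P [set v].

Definition adjacent P u v : Prop :=
  [/\ vertex P u, vertex P v, u != v & face P (conv [set u; v])].

Definition generalized_permutahedron P : Prop :=
  polytope P /\
  forall u v, adjacent P u v ->
    exists i j : 'I_n, u - v \in <[(delta_mx 0 i - delta_mx 0 j)%R]>%VS.

Definition lattice_point (a : 'rV[int]_n) : 'rV[R]_n := map_mx intr a.

Definition M_convex (S : set 'rV[int]_n) : Prop :=
  exists P, [/\ generalized_permutahedron P,
    forall v, vertex P v -> exists a, v = lattice_point a
    & S = [set a | P (lattice_point a)]].

Definition saturated_newton_polytope (K : fieldType) (f : laurent K n) : Prop :=
  [set a | conv (lattice_point @` supp f) (lattice_point a)] = supp f.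

End Polytopes.

Arguments M_convex R {n} S.
Arguments saturated_newton_polytope R {n K} f.

(* Main.v *)
(* All weights are positive for 0 < q, t < 1, hence (positivity at q = t = 1/2)
   nonzero and non-cancelling for indeterminate q, t, so supp E_mu is the set
   S_mu of contents of non-attacking fillings.  Read row by row from the
   basement, two boxes attack each other exactly when their reading positions
   differ by less than n.  Hence:
   - if mu_1 > 0 then box (1,1) contains 1 and shifting positions by one gives
     S_mu = e_1 + rot S_nu with nu = (mu_2, .., mu_n, mu_1 - 1);
   - if mu_i = 0 then S_mu is the union of S_nu and s_i S_nu with nu = s_i mu.
   Both steps preserve two properties: S is the set of integer points of the
   base polytope of a submodular function r all of whose values are attained,
   and S is closed under Bruhat-decreasing affine reflections.  The second
   property gives r(X,i+1) <= r(X,i) <= r(X,i+1) + 1 for X avoiding i, i+1, so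
   max(r(A), r(s_i A)) is submodular and its base points are those of S and s_i S. *)
Require Import Defs.
From mathcomp Require Import all_boot all_order all_algebra.
From mathcomp Require Import finmap classical_sets reals.
From mathcomp Require Import fintype finset fingroup perm zify lra.

Set Implicit Arguments.
Unset Strict Implicit.
Unset Printing Implicit Defensive.

Import Order.TTheory GRing.Theory Num.Theory.
Local Open Scope ring_scope.

Section BasePolytope.
Variable n : nat.
Implicit Types (a b : 'rV[int]_n) (A B : {set 'I_n}) (S : set 'rV[int]_n)
  (r : {set 'I_n} -> int).

Definition mass a A : int := \sum_(i in A) a 0 i.

Definition submodular r : Prop :=
  forall A B, r (A :|: B) + r (A :&: B) <= r A + r B.

Definition base_points r : set 'rV[int]_n :=
  [set a | (forall A, mass a A <= r A) /\ mass a [set: 'I_n]%SET = r [set: 'I_n]%SET]%classic.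

Definition base_set S : Prop :=
  exists r, [/\ submodular r, S = base_points r
              & forall A, exists2 a, S a & mass a A = r A].

Definition transfer (i j : 'I_n) a := a - delta_mx 0 i + delta_mx 0 j.

Lemma massU a A B : mass a (A :|: B) + mass a (A :&: B) = mass a A + mass a B.
Proof.
rewrite /mass (big_setID A (A := A :|: B)) /= (big_setID A (A := B)) /=.
rewrite setUK setDUl setDv set0U (setIC B A).
by rewrite -!addrA [X in _ + X]addrC.
Qed.

Lemma massD a A B : mass a (A :\: B) = mass a A - mass a (A :&: B).
Proof. by rewrite [mass a A](big_setID B) /= addrAC subrr add0r. Qed.

Lemma mass_transfer i j a A :
  mass (transfer i j a) A = mass a A - (i \in A)%:Z + (j \in A)%:Z.
Proof.
have E k : \sum_(l in A) (delta_mx 0 k : 'rV[int]_n) 0 l = (k \in A)%:Z.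
  rewrite (eq_bigr (fun l => (l == k)%:Z)) => [|l _]; last by rewrite mxE; case: (l == k).
  rewrite big_mkcond (bigD1 k) //= eqxx big1 ?addr0; first by case: (k \in A).
  by move=> l /negPf ->; case: ifP.
rewrite -!E /mass -sumrN -!big_split /=.
by apply: eq_bigr => l _; rewrite /transfer !mxE.
Qed.

Lemma tightU r a A B : submodular r -> base_points r a ->
  mass a A = r A -> mass a B = r B ->
  mass a (A :|: B) = r (A :|: B) /\ mass a (A :&: B) = r (A :&: B).
Proof.
move=> sr [ha _] hA hB.
have := sr A B; have := massU a A B; have := ha (A :|: B); have := ha (A :&: B).
by rewrite hA hB; lia.
Qed.

Lemma max_tight_avoiding r a i : submodular r -> base_points r a -> r set0 = 0 ->
  exists B, [/\ mass a B = r B, i \notin B &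
    forall A, mass a A = r A -> i \notin A -> A \subset B].
Proof.
move=> sr ba r0; pose P A := (mass a A == r A) && (i \notin A).
have P0 : P set0 by rewrite /P /mass big_set0 r0 eqxx in_set0.
case: (@arg_maxnP _ set0 P (fun A => #|A|) P0) => B /andP[/eqP tB iB] mB.
exists B; split => // A tA iA.
have : P (B :|: A).
  by rewrite /P in_setU negb_or iB iA !andbT; apply/eqP; case: (tightU sr ba tB tA).
move=> /mB /=; rewrite (geq_leqif (subset_leqif_card (subsetUl B A))) subUset.
by case/andP.
Qed.

Lemma min_tight_containing r a i : submodular r -> base_points r a ->
  exists B, [/\ mass a B = r B, i \in B &
    forall A, mass a A = r A -> i \in A -> B \subset A].
Proof.
move=> sr ba; pose P A := (mass a A == r A) && (i \in A).
have P0 : P setT by rewrite /P in_setT; case: ba => _ ->; rewrite eqxx.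
case: (@arg_minnP _ setT P (fun A => #|A|) P0) => B /andP[/eqP tB iB] mB.
exists B; split => // A tA iA.
have : P (B :&: A).
  by rewrite /P in_setI iB iA !andbT; apply/eqP; case: (tightU sr ba tB tA).
move=> /mB /=; rewrite (geq_leqif (subset_leqif_card (subsetIl B A))) subsetI.
by case/andP.
Qed.

Lemma symmetric_exchange S a b i : base_set S -> S a -> S b -> b 0 i < a 0 i ->
  exists j, [/\ i != j, S (transfer i j a) & S (transfer j i b)].
Proof.
move=> [r [sr -> at_r]] ba bb lt_i.
have r0 : r set0 = 0 by have [c _ <-] := at_r set0; rewrite /mass big_set0.
have [B [tB iB mB]] := max_tight_avoiding i sr ba r0.
have [A [tA iA mA]] := min_tight_containing i sr bb.
have [j /andP[jA jB] lt_j] : exists2 j, (j \in A) && (j \notin B) & a 0 j < b 0 j.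
  apply/exists_inP; apply: contraPT (sr A B); rewrite negb_exists_in => /forall_inP h.
  have : mass b (A :\: B) < mass a (A :\: B).
    rewrite /mass; have iAB : i \in A :\: B by rewrite in_setD iB.
    rewrite (bigD1 i) //= [ltRHS](bigD1 i) //=.
    apply: ltr_leD => //; apply: ler_sum => j /andP[]; rewrite in_setD andbC => /h.
    by rewrite -leNgt.
  have := ba.1 (A :|: B); have := bb.1 (A :&: B); have := massU a A B.
  by rewrite !massD -tA -tB; lia.
exists j; have nij : i != j by apply: contraTneq lt_j => <-; rewrite -leNgt ltW.
have tot (c : 'rV_n) k l : base_points r c ->
    mass (transfer k l c) [set: 'I_n]%SET = r [set: 'I_n].
  by case=> _ <-; rewrite mass_transfer !in_setT; lia.
split=> //; split; try exact: tot.
- move=> C; rewrite mass_transfer; have := ba.1 C.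
  case: (boolP (j \in C)) => jC; case: (boolP (i \in C)) => iC; rewrite ?subrK //; try lia.
  suff : mass a C != r C by lia.
  by apply: contra jB => /eqP tC; apply: (fintype.subsetP (mB _ tC iC)).
- move=> C; rewrite mass_transfer; have := bb.1 C.
  case: (boolP (j \in C)) => jC; case: (boolP (i \in C)) => iC; rewrite ?subrK //; try lia.
  suff : mass b C != r C by lia.
  by apply: contra jC => /eqP tC; apply: (fintype.subsetP (mA _ tC iC)).
Qed.

End BasePolytope.

Section ConvexHull.
Variables (R : realType) (n : nat).
Implicit Types (X : set 'rV[R]_n) (u v c x : 'rV[R]_n).

Lemma dotDr c u v : dot c (u + v) = dot c u + dot c v.
Proof. by rewrite /dot -big_split; apply: eq_bigr => i _; rewrite mxE mulrDr. Qed.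

Lemma dot_sum c k (p : 'I_k -> 'rV[R]_n) (w : 'I_k -> R) :
  dot c (\sum_(i < k) w i *: p i) = \sum_(i < k) w i * dot c (p i).
Proof.
rewrite /dot (eq_bigr (fun j => \sum_(i < k) w i * (c 0 j * p i 0 j))).
  by rewrite exchange_big; apply: eq_bigr => i _; rewrite mulr_sumr.
move=> j _; rewrite summxE mulr_sumr; apply: eq_bigr => i _.
by rewrite mxE mulrCA.
Qed.

Lemma sub_conv X x : X x -> conv X x.
Proof.
move=> Xx; exists 1%N, (fun=> x), (fun=> 1).
by split=> // [|]; rewrite big_ord1 // scale1r.
Qed.

Lemma conv_dot_le X c (M : R) x :
  (forall y, X y -> dot c y <= M) -> conv X x -> dot c x <= M.
Proof.
move=> hX [k [p [w [Xp w0 w1 ->]]]]; rewrite dot_sum.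
rewrite -[M]mul1r -w1 mulr_suml; apply: ler_sum => i _.
by rewrite ler_wpM2l // hX.
Qed.

Lemma vertex_conv X v : vertex (conv X) v -> X v.
Proof.
move=> [c fc]; have : [set v]%classic v by [].
rewrite fc => -[[k [p [w [Xp w0 w1 ev]]]] maxv].
suff [i hi] : exists i, dot c v <= dot c (p i).
  have : [set v]%classic (p i).
    rewrite fc; split; first exact: sub_conv.
    by move=> y /maxv h; apply: le_trans h hi.
  by move=> /= <-.
have [/existsP//|] := boolP [exists i, dot c v <= dot c (p i)].
rewrite negb_exists => /forallP h.
have s0 : \sum_(i < k) w i * (dot c v - dot c (p i)) = 0.
  rewrite (eq_bigr (fun i => w i * dot c v - w i * dot c (p i))).
    by rewrite sumrB -mulr_suml w1 mul1r -dot_sum -ev subrr.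
  by move=> i _; rewrite mulrBr.
suff : \sum_(i < k) w i = 0 by rewrite w1 => /eqP; rewrite oner_eq0.
apply: big1 => i _; have := h i; rewrite -ltNge -subr_gt0 => pi.
have /eqP := s0; rewrite psumr_eq0 => [/allP /(_ i)|j _].
  by rewrite mem_index_enum mulf_eq0 (gt_eqF pi) orbF => /(_ isT)/eqP.
by rewrite mulr_ge0 // subr_ge0; have := h j; rewrite -ltNge => /ltW.
Qed.

Lemma conv2_line u v x : conv [set u; v]%classic x -> exists l, x - u = l *: (v - u).
Proof.
move=> [k [p [w [Xp w0 w1 ->]]]].
exists (\sum_(i < k | p i != u) w i).
rewrite -[u in LHS]scale1r -w1 scaler_suml -sumrB scaler_suml.
rewrite [RHS]big_mkcond; apply: eq_bigr => i _.
rewrite -scalerBr; case: eqVneq => [->|/eqP ne]; first by rewrite subrr scaler0.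
by case: (Xp i) => //= ->.
Qed.

End ConvexHull.

Section BaseHull.
Variables (R : realType) (n : nat).
Implicit Types (S : set 'rV[int]_n) (a b : 'rV[int]_n).
Local Notation lat := (@lattice_point R n).

Lemma dot_indicator (A : {set 'I_n}) a :
  dot (\row_i (i \in A)%:R) (lat a) = (mass a A)%:~R.
Proof.
rewrite /dot /mass [in RHS]big_mkcond rmorph_sum; apply: eq_bigr => i _ /=.
by rewrite !mxE; case: (i \in A); rewrite ?mul1r ?mul0r.
Qed.

Lemma dotNl (c x : 'rV[R]_n) : dot (- c) x = - dot c x.
Proof. by rewrite /dot -sumrN; apply: eq_bigr => i _; rewrite mxE mulNr. Qed.

Lemma base_set_saturated S : base_set S ->
  [set a | conv (lat @` S) (lat a)]%classic = S.
Proof.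
move=> [r [_ -> _]]; apply/seteqP; split=> a /=; last first.
  by move=> Sa; apply: sub_conv; exists a.
have bnd A : conv (lat @` base_points r)%classic (lat a) -> mass a A <= r A.
  rewrite -(ler_int R) -dot_indicator; apply: conv_dot_le => _ [b [hb _] <-].
  by rewrite dot_indicator ler_int.
move=> ha; split; first by move=> A; exact: bnd.
apply/eqP; rewrite eq_le bnd //= -(ler_int R) -dot_indicator -lerN2 -dotNl.
move: ha; apply: conv_dot_le => _ [b [_ hb] <-].
by rewrite dotNl dot_indicator hb.
Qed.

Lemma lat_transfer i j a :
  lat (transfer i j a) = lat a - delta_mx 0 i + delta_mx 0 j.
Proof.
by apply/rowP => k; rewrite !mxE rmorphD rmorphB /= !rmorph_nat.
Qed.

Lemma base_set_hull_permutahedron S (s : seq _) : S = [set` s]%classic -> base_set S ->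
  generalized_permutahedron (conv (lat @` S)%classic).
Proof.
move=> Ss bS; split.
  exists (map lat s); congr (conv _); rewrite Ss; apply/seteqP; split=> x /=.
    by move=> [a ha <-]; apply: map_f.
  by move=> /mapP[a ha ->]; exists a.
move=> u v [vu vv nuv [c fc]].
have [a Sa eu] := vertex_conv vu; have [b Sb ev] := vertex_conv vv.
have [i lt_i] : exists i, b 0 i < a 0 i.
  have [/existsP//|] := boolP [exists i, b 0 i < a 0 i].
  rewrite negb_exists => /forallP h; case/eqP: nuv; rewrite -eu -ev.
  congr (lat _); apply/rowP => i.
  have [r [_ Sr _]] := bS; move: Sa Sb; rewrite Sr => -[_ ra] [_ rb].
  have := eqxx (r [set: 'I_n]%SET); rewrite -{1}ra -rb -subr_eq0 /mass -sumrB.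
  rewrite -oppr_eq0 -sumrN psumr_eq0 => [/allP/(_ i)|j _].
    by rewrite mem_index_enum in_setT /= oppr_eq0 subr_eq0 => /(_ isT)/eqP.
  by rewrite opprB subr_ge0; have := h j; rewrite -leNgt.
have [j [nij Sa' Sb']] := symmetric_exchange bS Sa Sb lt_i.
have inface w : [set u; v]%classic w -> conv (lat @` S)%classic w /\
    forall y, conv (lat @` S)%classic y -> dot c y <= dot c w.
  move=> hw; suff : conv [set u; v]%classic w by rewrite fc.
  exact: sub_conv.
have [cu mu] := inface u (or_introl erefl).
have [cv mv] := inface v (or_intror erefl).
have cS d : S d -> conv (lat @` S)%classic (lat d) by move=> Sd; apply: sub_conv; exists d.
exists i, j.
have : conv [set u; v]%classic (lat (transfer i j a)).
  rewrite fc; split=> [|y /mu]; first exact: cS.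
  move=> /le_trans; apply.
  have := mv _ (cS _ Sb').
  have : dot c (lat (transfer i j a)) + dot c (lat (transfer j i b))
      = dot c u + dot c v.
    rewrite -!dotDr !lat_transfer eu ev; congr (dot c _).
    by rewrite addrACA [X in X + _]addrACA -opprD [_ + delta_mx 0 j]addrC subrK.
  lra.
move=> /conv2_line[l]; rewrite lat_transfer eu => e.
have l0 : l != 0.
  apply/eqP => l0; move: e; rewrite l0 scale0r => /rowP/(_ i).
  rewrite !mxE !eqxx (negPf nij) /=; lra.
apply/vlineP; exists l^-1.
rewrite -[LHS]scale1r -(mulVf l0) -scalerA; congr (_ *: _).
by rewrite -opprB scalerN -e -[u - _ + _]addrA [u + _]addrC addrK opprD opprK.
Qed.

Lemma base_set_M_convex S (s : seq _) : S = [set` s]%classic -> base_set S -> M_convex R S.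
Proof.
move=> Ss bS; exists (conv (lat @` S)%classic); split.
- exact: base_set_hull_permutahedron Ss bS.
- by move=> v /vertex_conv[a _ <-]; exists a.
- by rewrite base_set_saturated.
Qed.

End BaseHull.

Section Operations.
Variable n : nat.
Implicit Types (a b c : 'rV[int]_n) (A B : {set 'I_n}) (S : set 'rV[int]_n).

Lemma mass_col_perm (s : 'S_n) a A : mass a A = mass (col_perm s a) (s @^-1: A).
Proof.
rewrite /mass (reindex_inj (@perm_inj _ s)) /=; apply: eq_big => i.
  by rewrite inE.
by rewrite mxE.
Qed.

Lemma massDl a b A : mass (a + b) A = mass a A + mass b A.
Proof. by rewrite /mass -big_split; apply: eq_bigr => i _; rewrite mxE. Qed.

Lemma base_set_affine S (s : 'S_n) c : base_set S ->
  base_set [set a | S (col_perm s a + c)]%classic.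
Proof.
move=> [r [sr -> at_r]].
have massE a A : mass a A = mass (col_perm s a + c) (s @^-1: A) - mass c (s @^-1: A).
  by rewrite massDl addrK -mass_col_perm.
exists (fun A => r (s @^-1: A) - mass c (s @^-1: A)); split.
- move=> A B; rewrite preimsetU preimsetI.
  have := sr (s @^-1: A) (s @^-1: B); have := massU c (s @^-1: A) (s @^-1: B); lia.
- apply/seteqP; split=> a /=.
    case=> h1 h2; split=> [A|]; rewrite massE.
      by rewrite lerD2r.
    by rewrite preimsetT h2.
  case=> h1 h2; split=> [A|].
    have := h1 (s @: A); rewrite massE lerD2r.
    suff -> : s @^-1: (s @: A) = A by [].
    by apply/setP => i; rewrite inE mem_imset //; apply: perm_inj.
  by move: h2; rewrite massE preimsetT => /addIr.
- move=> A; have [a ha ea] := at_r (s @^-1: A).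
  exists (col_perm s^-1%g (a - c)); last first.
    rewrite massE -ea; congr (mass _ _ - _).
    by rewrite -col_permM mulgV col_perm1 subrK.
  by rewrite /= -col_permM mulgV col_perm1 subrK.
Qed.

Definition reflection_closed S : Prop :=
  forall (i j : 'I_n) a, (i < j)%N -> S a ->
    (a 0 i < a 0 j -> S (xcol i j a)) /\
    (a 0 j < a 0 i -> S (transfer j i (xcol i j a))).

Lemma xcolK i j : involutive (@xcol int 1 n i j).
Proof. by move=> a; apply/rowP => k; rewrite !mxE tpermK. Qed.

End Operations.
Section SwapUnion.
Variables (n : nat) (i j : 'I_n) (S : set 'rV[int]_n).
Hypotheses (nij : i != j) (bS : base_set S).
Implicit Types (a b c : 'rV[int]_n) (A B : {set 'I_n}).
Local Notation s := (tperm i j).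

Hypothesis swapS : forall a, S a -> a 0 i < a 0 j -> S (xcol i j a).
Hypothesis affineS : forall a, S a -> a 0 j < a 0 i -> S (transfer j i (xcol i j a)).

Lemma mass_swap_mixed a A : i \in A -> j \notin A ->
  mass a (s @^-1: A) = mass a A - a 0 i + a 0 j.
Proof.
move=> iA jA; rewrite /mass (bigD1 j) /=; last by rewrite inE tpermR.
rewrite [in RHS](bigD1 i) //= [X in _ = X + _]addrAC subrr add0r addrC; congr (_ + _).
apply: eq_bigl => k; rewrite inE.
by case: tpermP => [->|->|/eqP ki /eqP kj]; rewrite ?iA ?(negPf jA) ?eqxx ?(negPf nij) ?ki ?kj.
Qed.

Lemma swap_preim_id A : (i \in A) = (j \in A) -> s @^-1: A = A.
Proof.
by move=> e; apply/setP => k; rewrite inE; case: tpermP => // ->; rewrite e.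
Qed.

Lemma swap_preimK A : s @^-1: (s @^-1: A) = A.
Proof. by apply/setP => k; rewrite !inE tpermK. Qed.

Lemma mass_xcol a A : mass (xcol i j a) A = mass a (s @^-1: A).
Proof. by rewrite [RHS](mass_col_perm s) swap_preimK. Qed.

(* Apply the two reflections to points maximizing the mass of [A] or [s A]. *)
Lemma rank_swap_bounds r A : S = base_points r ->
  (forall A, exists2 a, S a & mass a A = r A) -> i \in A -> j \notin A ->
  r (s @^-1: A) <= r A <= r (s @^-1: A) + 1.
Proof.
move=> Sr at_r iA jA.
have le_r a B : S a -> mass a B <= r B by rewrite Sr => -[].
apply/andP; split.
  have [a Sa <-] := at_r (s @^-1: A); have := le_r _ A Sa.
  case: (lerP (a 0 j) (a 0 i)) => h; first by rewrite mass_swap_mixed //; lia.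
  by have := le_r _ A (swapS Sa h); rewrite mass_xcol.
have [a Sa <-] := at_r A; have := le_r _ (s @^-1: A) Sa.
case: (ltrP (a 0 j) (a 0 i)) => h; last by rewrite mass_swap_mixed //; lia.
have := le_r _ (s @^-1: A) (affineS Sa h).
by rewrite mass_transfer mass_xcol swap_preimK !inE tpermL tpermR iA (negPf jA); lia.
Qed.

Lemma base_set_swap_union :
  base_set [set a | S a \/ S (xcol i j a)]%classic.
Proof.
have [r [sr Sr at_r]] := bS.
have bounds A := rank_swap_bounds Sr at_r (A := A).
pose r' A : int := Num.max (r A) (r (s @^-1: A)).
have ge1 A : r A <= r' A by rewrite le_max lexx.
have ge2 A : r (s @^-1: A) <= r' A by rewrite le_max lexx orbT.
have r'_swap A : r' (s @^-1: A) = r' A by rewrite /r' swap_preimK maxC.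
have r'_i A : (j \in A) ==> (i \in A) -> r' A = r A.
  move=> ij; apply/max_idPl; case: (boolP (i \in A)) ij => iA.
    case: (boolP (j \in A)) => jA _; first by rewrite swap_preim_id ?iA ?jA.
    by case/andP: (bounds _ iA jA).
  by rewrite implybF => jA; rewrite swap_preim_id // (negPf iA) (negPf jA).
have r'_j A : (i \in A) ==> (j \in A) -> r' A = r (s @^-1: A).
  by move=> ij; rewrite -r'_swap r'_i // !inE tpermL tpermR.
exists r'; split.
- move=> A B.
  have := sr A B; have := sr (s @^-1: A) (s @^-1: B).
  have -> : (s @^-1: A) :|: (s @^-1: B) = s @^-1: (A :|: B) by rewrite preimsetU.
  have -> : (s @^-1: A) :&: (s @^-1: B) = s @^-1: (A :&: B) by rewrite preimsetI.
  have := ge1 A; have := ge1 B; have := ge2 A; have := ge2 B.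
  have := r'_i A; have := r'_i B; have := r'_i (A :|: B); have := r'_i (A :&: B).
  have := r'_j A; have := r'_j B; have := r'_j (A :|: B); have := r'_j (A :&: B).
  rewrite !inE.
  by case: (i \in A) (i \in B) (j \in A) (j \in B) => [] [] [] [] /=; lia.
- have dom a : a 0 j <= a 0 i -> base_points r' a -> S a.
    move=> h [h1 h2]; rewrite Sr; split; last by rewrite h2 r'_i ?in_setT.
    move=> A; have := h1 A; case: (boolP ((j \in A) ==> (i \in A))) => [/r'_i -> //|].
    rewrite negb_imply => /andP[jA iA] _.
    have iA' : i \in s @^-1: A by rewrite inE tpermL.
    have jA' : j \notin s @^-1: A by rewrite inE tpermR.
    have := bounds _ iA' jA'; have := mass_swap_mixed a iA' jA'.
    have := h1 (s @^-1: A); rewrite r'_swap r'_j ?(negPf iA) // swap_preimK.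
    have := sr A (s @^-1: A); have := massU a A (s @^-1: A).
    have := h1 (A :|: s @^-1: A); have := h1 (A :&: s @^-1: A).
    rewrite !r'_i ?inE ?tpermL ?tpermR ?jA ?(negPf iA) //; lia.
  apply/seteqP; split=> a /=.
    case=> [|Sa].
      by rewrite Sr => -[h1 h2]; split=> [A|]; [apply: le_trans (h1 A) _ | rewrite r'_i ?in_setT].
    move: Sa; rewrite Sr => -[h1 h2]; split=> [A|].
      by apply: le_trans (ge2 A); rewrite -[A in mass a A]swap_preimK -mass_xcol; exact: h1.
    by rewrite r'_i ?in_setT // -h2 mass_xcol preimsetT.
  move=> ba; case: (lerP (a 0 j) (a 0 i)) => h; [left | right]; apply: dom => //.
    by rewrite !mxE tpermL tpermR ltW.
  case: ba => h1 h2; split=> [A|]; rewrite mass_xcol.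
    by rewrite -r'_swap; exact: h1.
  by rewrite preimsetT.
- move=> A; rewrite /r'; case: (leP (r A) (r (s @^-1: A))) => _.
    have [a Sa <-] := at_r (s @^-1: A).
    by exists (xcol i j a); rewrite ?mass_xcol //=; right; rewrite xcolK.
  by have [a Sa <-] := at_r A; exists a => //; left.
Qed.

End SwapUnion.

Section Reflections.

Lemma reflection_closed_swap_union n (S : set 'rV[int]_n) (i j : 'I_n) :
  j = i.+1 :> nat -> reflection_closed S ->
  reflection_closed [set a | S a \/ S (xcol i j a)]%classic.
Proof.
move=> ji rS k l a /= kl Sa.
pose s : 'S_n := tperm i j.
have lt_ij : (i < j)%N by rewrite ji.
have xE (b : 'rV[int]_n) : xcol i j (xcol k l b) = xcol (s k) (s l) (xcol i j b).
  apply/rowP => x; rewrite !mxE; congr (b _ _).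
  by rewrite -{2}[x](tpermK i j) -/s -(inj_tperm _ _ _ (@perm_inj _ s)) tpermK.
have tE b : xcol i j (transfer l k b) = transfer (s l) (s k) (xcol i j b).
  apply/rowP => x; by rewrite !mxE eqxx /= !(can2_eq (tpermK i j) (tpermK i j)).
have [ekl|nkl] := boolP ((k == i) && (l == j)).
  case/andP: ekl => /eqP ek /eqP el; subst k l; split=> h /=.
    by case: Sa => Sa; [right | left]; rewrite ?xcolK.
  case: Sa => [Sa|Sa]; left; first by apply: (rS _ _ _ lt_ij Sa).2.
  have Sa' : S a.
    by have := (rS _ _ _ lt_ij Sa).1; rewrite xcolK !mxE tpermL tpermR; apply.
  exact: (rS _ _ _ lt_ij Sa').2.
have kl' : (s k < s l)%N.
  rewrite /s; do 2 case: tpermP => *; subst; move: nkl; rewrite ?eqxx //= -!val_eqE /=; lia.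
case: Sa => Sa.
  by have [h1 h2] := rS _ _ _ kl Sa; split=> h; left; auto.
have [h1 h2] := rS _ _ _ kl' Sa.
move: h1 h2; rewrite !mxE !tpermK -xE -tE => h1 h2.
by split=> h; right; auto.
Qed.

Definition rotate n (a : 'rV[int]_n.+1) : 'rV[int]_n.+1 :=
  \row_k (a 0 (ordS k) - (k == ord_max)%:Z).

Lemma base_set_rotate n (S : set 'rV[int]_n.+1) : base_set S ->
  base_set [set a | S (rotate a)]%classic.
Proof.
move=> /(base_set_affine (perm (@ordS_inj n.+1)) (- delta_mx 0 ord_max)).
congr (base_set _); apply/seteqP; split=> a /=; congr S.
  by apply/rowP => k; rewrite !mxE permE; case: (k == _).
by apply/rowP => k; rewrite !mxE permE; case: (k == _).
Qed.

Lemma reflection_closed_rotate n (S : set 'rV[int]_n.+1) : reflection_closed S ->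
  reflection_closed [set a | S (rotate a)]%classic.
Proof.
move=> rS k l a /= kl Sa.
have [k0 ek] : exists k0 : 'I_n.+1, k = ordS k0 by exists (ord_pred k); rewrite ord_predK.
have [l0 el] : exists l0 : 'I_n.+1, l = ordS l0 by exists (ord_pred l); rewrite ord_predK.
have l0n : l0 != ord_max.
  by apply: contraTneq kl => l0n; rewrite el l0n /= modnn.
have tE b : rotate (transfer l k b) = transfer l0 k0 (rotate b).
  apply/rowP => x; rewrite !mxE eqxx /= el ek !(inj_eq (@ordS_inj _)).
  by rewrite -!addrA; congr (_ + _); lia.
have xE b x : xcol k l b 0 (ordS x) = b 0 (ordS (tperm k0 l0 x)).
  by rewrite !mxE ek el (inj_tperm _ _ _ (@ordS_inj _)).
have rotE b x : rotate b 0 x = b 0 (ordS x) - (x == ord_max)%:Z by rewrite mxE.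
have [k0n|k0n] := eqVneq k0 ord_max.
  have lt0 : (l0 < k0)%N by rewrite k0n ltn_neqAle -ltnS ltn_ord andbT.
  have xE' : rotate (xcol k l a) = transfer k0 l0 (xcol l0 k0 (rotate a)).
    have nlk : (l0 == k0) = false by rewrite k0n (negPf l0n).
    have nkl : (k0 == l0) = false by rewrite eq_sym.
    apply/rowP => x; rewrite rotE xE !mxE eqxx /= [tperm l0 k0]tpermC -k0n.
    by case: tpermP => [->|->|/eqP/negPf -> /eqP/negPf ->]; rewrite ?eqxx ?nkl ?nlk /=; lia.
  have [h1 h2] := rS _ _ _ lt0 Sa.
  split.
    rewrite xE' => h; apply: h2; rewrite !rotE -ek -el k0n eqxx; lia.
  have rE : rotate (transfer l k (xcol k l a)) = xcol l0 k0 (rotate a).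
    by rewrite tE xE'; apply/rowP => x; rewrite !mxE eqxx /=; lia.
  have nlk' := negPf l0n.
  move=> h; rewrite rE; have [lt1|] := ltrP (rotate a 0 l0) (rotate a 0 k0).
    exact: h1.
  move=> ge1; have e : rotate a 0 l0 = rotate a 0 k0.
    by move: ge1; rewrite !rotE -ek -el nlk' k0n eqxx; lia.
  apply: (eq_ind_r S Sa); apply/rowP => x; rewrite [LHS]mxE.
  by case: tpermP => [->|->|//]; rewrite e.
have lt0 : (k0 < l0)%N.
  have := kl; rewrite ek el /= !modn_small //.
  - by have := ltn_ord l0; move: l0n; rewrite -val_eqE /=; lia.
  - by have := ltn_ord k0; move: k0n; rewrite -val_eqE /=; lia.
have xE' : rotate (xcol k l a) = xcol k0 l0 (rotate a).
  apply/rowP => x; rewrite rotE xE !mxE; congr (_ - _%:Z).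
  by case: tpermP => [->|->|//]; rewrite (negPf l0n) (negPf k0n).
by have := rS _ _ _ lt0 Sa; rewrite !rotE (negPf k0n) (negPf l0n) !subr0 -ek -el tE xE'.
Qed.
End Reflections.

Section Fillings.
Variable n : nat.
Implicit Types (mu nu : 'I_n -> nat) (g h : 'I_n -> nat -> 'I_n) (i j c d : 'I_n).

(* [g i k] is the entry of column i in row k + 1 (the first row above the
   basement is k = 0), irrelevant when [mu i <= k]; the basement is only present
   through the first condition of [admissible].  [precedes] says that the reading
   position k * n + i is less than n places before l * n + j. *)
Definition precedes i k j l : bool :=
  ((k == l) && (i < j)%N) || ((l == k.+1) && (j < i)%N).

Definition admissible mu g : Prop :=
  (forall d c, (d < c)%N -> (0 < mu d)%N -> g d 0%N != c) /\
  (forall i k j l, (k < mu i)%N -> (l < mu j)%N -> precedes i k j l -> g i k != g j l).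

Definition entry_content mu g : 'rV[int]_n :=
  \row_a \sum_i \sum_(k < mu i) (g i k == a)%:Z.

Definition contents mu : set 'rV[int]_n :=
  [set a | exists2 g, admissible mu g & a = entry_content mu g]%classic.

Lemma eq_admissible mu g h : (forall i k, (k < mu i)%N -> g i k = h i k) ->
  admissible mu g -> admissible mu h.
Proof.
move=> e [h1 h2]; split=> [d c dc d0|i k j l ki lj p]; first by rewrite -e //; apply: h1.
by rewrite -!e //; apply: h2.
Qed.

Lemma eq_entry_content mu g h : (forall i k, (k < mu i)%N -> g i k = h i k) ->
  entry_content mu g = entry_content mu h.
Proof.
by move=> e; apply/rowP => a; rewrite !mxE; apply: eq_bigr => i _;
  apply: eq_bigr => k _; rewrite e.
Qed.

Section Bridge.
Variable mu : 'I_n -> nat.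
Implicit Type s : filling mu.

Definition entry s i k : 'I_n :=
  aug s (Tagged (fun i => 'I_(mu i).+1) (inord k.+1 : 'I_(mu i).+1)).

Lemma aug_row0 s i (k : 'I_(mu i).+1) : k = 0%N :> nat ->
  aug s (Tagged (fun i => 'I_(mu i).+1) k) = i.
Proof.
by move=> k0; rewrite /aug /=; case: unliftP => // k' ek; move: k0; rewrite ek.
Qed.

Lemma aug_rowS s i (k : 'I_(mu i).+1) : k != 0%N :> nat ->
  aug s (Tagged (fun i => 'I_(mu i).+1) k) = entry s i k.-1.
Proof.
by move=> k0; rewrite /entry prednK ?lt0n // inord_val.
Qed.

Lemma entry_filling s i (k : 'I_(mu i)) : entry s i k = s (Tagged (fun i => 'I_(mu i)) k).
Proof.
rewrite /entry (_ : inord k.+1 = lift ord0 k); first by rewrite /aug /= liftK.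
by apply: val_inj; rewrite /= inordK // ltnS ltn_ord.
Qed.

Lemma nonattackingP s : reflect (admissible mu (entry s)) (nonattacking s).
Proof.
apply: (iffP forallP) => [na|[h1 h2] [i k]].
  have {}na u v : attack u v -> aug s u != aug s v.
    by have /forallP/(_ v)/implyP := na u.
  split=> [d c dc d0|i k j l ki lj p].
    pose u := Tagged (fun i => 'I_(mu i).+1) (inord 1 : 'I_(mu d).+1).
    pose v := Tagged (fun i => 'I_(mu i).+1) (ord0 : 'I_(mu c).+1).
    have := na u v; rewrite [aug s v]aug_row0 //; apply.
    have uv : brow u = (brow v).+1 by rewrite /brow /= inordK.
    apply/andP; split; last by rewrite /attack_down uv eqxx dc orbT.
    by apply/eqP => e; move: uv; rewrite e => /eqP; rewrite eqn_leq ltnn andbF.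
  apply: na; set u := Tagged _ _; set v := Tagged _ _.
  have ru : brow u = k.+1 by rewrite /brow /= inordK.
  have rv : brow v = l.+1 by rewrite /brow /= inordK.
  rewrite /attack /attack_down ru rv.
  have -> /= : u != v.
    apply/eqP => e; have ij : i = j := congr1 (@bcol n mu) e.
    have := congr1 (@brow n mu) e; rewrite ru rv.
    by move: p; rewrite /precedes ij; lia.
  by move: p; rewrite /precedes /bcol /=; lia.
apply/forallP => -[j l]; apply/implyP.
have hp (i' j' : 'I_n) (k' : 'I_(mu i').+1) (l' : 'I_(mu j').+1) :
    precedes i' k' j' l' ->
    aug s (Tagged (fun i => 'I_(mu i).+1) k') != aug s (Tagged (fun i => 'I_(mu i).+1) l').
  move=> p; case: (posnP k') => k0.
    rewrite (aug_row0 s k0); case: (posnP l') => l0.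
      by rewrite (aug_row0 s l0) -val_eqE /=; move: p; rewrite /precedes k0 l0; lia.
    rewrite (aug_rowS s) -?lt0n //.
    have -> : l'.-1 = 0%N by move: p; rewrite /precedes k0; lia.
    rewrite eq_sym; apply: h1; first by move: p; rewrite /precedes k0; lia.
    by have := ltn_ord l'; lia.
  have l0 : (0 < l')%N by move: p; rewrite /precedes; lia.
  rewrite !(aug_rowS s) -?lt0n //; apply: h2.
  - by have := ltn_ord k'; lia.
  - by have := ltn_ord l'; lia.
  - by move: p; rewrite /precedes; lia.
rewrite /attack /attack_down /brow /bcol /= => /andP[nuv auv].
have [p|np] := boolP (precedes i k j l); first exact: hp.
rewrite eq_sym; apply: hp.
have [eij|nij] := eqVneq i j.
  by subst j; case/eqP: nuv; congr (Tagged _ _); apply: val_inj; move: auv => /=; lia.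
by move: auv np nij; rewrite /precedes -val_eqE /=; lia.
Qed.

Lemma contentE s : content s = entry_content mu (entry s).
Proof.
apply/rowP => a; rewrite /content summxE mxE.
rewrite (sig_big_dep (fun=> true) (fun i => xpredT)
  (fun i (k : 'I_(mu i)) => (entry s i k == a)%:Z)) /=.
apply: eq_bigr => -[i k] _; rewrite entry_filling mxE eqxx eq_sym.
by case: (_ == _).
Qed.

Lemma contentsE :
  [set a | exists2 s : filling mu, nonattacking s & a = content s]%classic = contents mu.
Proof.
apply/seteqP; split=> a /= [].
  by move=> s /nonattackingP na ->; exists (entry s); rewrite ?contentE.
move=> g ag ->; pose s : filling mu := [ffun u : dg mu => g (tag u) (tagged u)].
have e i k : (k < mu i)%N -> g i k = entry s i k.
  by move=> ki; rewrite -[k]/(nat_of_ord (Ordinal ki)) entry_filling ffunE.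
exists s; last by rewrite contentE; apply: eq_entry_content.
by apply/nonattackingP; apply: eq_admissible ag.
Qed.

End Bridge.

Section EmptyColumn.
Variables (i j : 'I_n) (mu : 'I_n -> nat).
Hypotheses (ji : j = i.+1 :> nat) (mui : mu i = 0%N).
Local Notation s := (tperm i j).
Let nu k := mu (s k).

Let nuj : nu j = 0%N. Proof. by rewrite /nu tpermR. Qed.

Lemma precedes_shift c k d l (lo hi : 'I_n) :
  hi = lo.+1 :> nat \/ lo = hi.+1 :> nat -> c != lo -> d != lo ->
  precedes c k d l -> precedes (tperm lo hi c) k (tperm lo hi d) l.
Proof.
move=> lohi; rewrite /precedes.
case: (tpermP lo hi c) => [->|->|/eqP c1 /eqP c2]; rewrite ?eqxx //;
case: (tpermP lo hi d) => [->|->|/eqP d1 /eqP d2]; rewrite ?eqxx //=.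
- by move=> _ _; lia.
- by move: d1 d2; rewrite -!val_eqE /=; lia.
- by move: c1 c2; rewrite -!val_eqE /=; lia.
Qed.

Lemma admissible_unshift h : admissible nu h -> admissible mu (fun c => h (s c)).
Proof.
move=> [h1 h2]; split=> [d c dc d0|c k d l kc ld p].
  have di : d != i by apply: contraTneq d0 => ->; rewrite mui.
  apply: h1; last by rewrite /nu tpermK.
  by move: dc di; case: tpermP => [->|->|]; rewrite ?eqxx //; lia.
have ci : c != i by apply: contraTneq kc => ->; rewrite mui.
have di : d != i by apply: contraTneq ld => ->; rewrite mui.
by apply: h2; rewrite ?/nu ?tpermK //; apply: precedes_shift => //; left.
Qed.

Lemma admissible_shift g : g j 0%N != j -> admissible mu g ->
  admissible nu (fun c => g (s c)).
Proof.
move=> gj [h1 h2]; split=> [d c dc d0|c k d l kc ld p].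
  have dj : d != j by apply: contraTneq d0 => ->; rewrite nuj.
  have [ecj|cj] := eqVneq c j; last first.
    have := h1 (s d) c; apply=> //; move: dc cj; rewrite -val_eqE /=.
    by case: tpermP dj => // [->|->]; rewrite ?eqxx //; lia.
  subst c; have [->|di] := eqVneq d i; first by rewrite tpermL.
  have sd : s d = d by rewrite tpermD // eq_sym.
  by apply: h1 => //; rewrite sd; move: dc dj; rewrite -val_eqE /=; lia.
have cj : c != j by apply: contraTneq kc => ->; rewrite nuj.
have dj : d != j by apply: contraTneq ld => ->; rewrite nuj.
by apply: h2 => //; rewrite tpermC; apply: precedes_shift => //; right.
Qed.

Lemma admissible_swap_values g : admissible mu g ->
  admissible mu (fun c k => s (g c k)).
Proof.
move=> [h1 h2]; split=> [d c dc d0|c k d l kc ld p]; last first.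
  by rewrite (inj_eq perm_inj); apply: h2.
have di : d != i by apply: contraTneq d0 => ->; rewrite mui.
rewrite (can2_eq (tpermK i j) (tpermK i j)); apply: h1 => //.
by move: dc di; rewrite -val_eqE /=; case: tpermP => [->|->|//]; lia.
Qed.

Lemma entry_content_shift h : entry_content mu (fun c => h (s c)) = entry_content nu h.
Proof.
apply/rowP => a; rewrite !mxE [RHS](reindex_inj (@perm_inj _ s)) /=.
by apply: eq_bigr => c _; rewrite /nu tpermK.
Qed.

Lemma entry_content_swap_values g :
  entry_content mu (fun c k => s (g c k)) = xcol i j (entry_content mu g).
Proof.
apply/rowP => a; rewrite !mxE; apply: eq_bigr => c _; apply: eq_bigr => k _.
by rewrite (can2_eq (tpermK i j) (tpermK i j)).
Qed.

Lemma contents_empty_column :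
  contents mu = [set a | contents nu a \/ contents nu (xcol i j a)]%classic.
Proof.
have sub a : contents nu a -> contents mu a.
  move=> [h ah ->]; exists (fun c => h (s c)); first exact: admissible_unshift.
  by rewrite entry_content_shift.
apply/seteqP; split=> a /=.
  have wS g : g j 0%N != j -> admissible mu g -> contents nu (entry_content mu g).
    move=> gj ag; exists (fun c => g (s c)); first exact: admissible_shift.
    rewrite -entry_content_shift; apply: eq_entry_content => c k _; by rewrite tpermK.
  move=> [g ag ->]; have [gj|gj] := eqVneq (g j 0%N) j; last by left; apply: wS.
  right; rewrite -entry_content_swap_values; apply: wS; last exact: admissible_swap_values.
  by rewrite gj tpermR -val_eqE /=; lia.
case=> [|/sub [g ag e]]; first exact: sub.
exists (fun c k => s (g c k)); first exact: admissible_swap_values.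
by rewrite entry_content_swap_values -e xcolK.
Qed.

End EmptyColumn.

End Fillings.

Lemma val_ordS n (c : 'I_n.+1) : ordS c = (if c == ord_max then 0 else c.+1)%N :> nat.
Proof.
case: eqVneq => [->|] /=; first by rewrite modnn.
by rewrite -val_eqE /= => h; rewrite modn_small //; have := ltn_ord c; lia.
Qed.

Lemma ordS_eq0 n (c : 'I_n.+1) : (ordS c == ord0) = (c == ord_max).
Proof.
have -> : (ordS c == ord0) = (ordS c == 0%N :> nat) by [].
by rewrite val_ordS; case: (c == _).
Qed.

Lemma precedes_ordS n (c d : 'I_n.+1) k l :
  precedes (ordS c) (k + (c == ord_max))%N (ordS d) (l + (d == ord_max))%N
  = precedes c k d l.
Proof.
have := ltn_ord c; have := ltn_ord d; rewrite /precedes !val_ordS.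
have [->|] := eqVneq c ord_max; have [->|] := eqVneq d ord_max;
  rewrite -?val_eqE /= => *; apply/idP/idP; lia.
Qed.

Section Rotation.
Variables (n : nat) (mu : 'I_n.+1 -> nat).
Hypothesis mu0 : (0 < mu ord0)%N.
Implicit Types (g h : 'I_n.+1 -> nat -> 'I_n.+1) (c d : 'I_n.+1).
Let nu c := (mu (ordS c) - (c == ord_max))%N.

Definition rotate_filling g c k := ord_pred (g (ordS c) (k + (c == ord_max))%N).

Definition unrotate_filling h c k :=
  if (c == ord0) && (k == 0%N) then ord0 else ordS (h (ord_pred c) (k - (c == ord0))%N).

Lemma admissible00 g : admissible mu g -> g ord0 0%N = ord0.
Proof.
move=> [h1 h2]; apply/eqP/negPn/negP => g0.
have := h1 ord0 (g ord0 0%N); rewrite eqxx => /(_ _ mu0) h.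
by apply: notF; apply: h; rewrite lt0n.
Qed.

Lemma nu_bound c k : (k < nu c)%N = (k + (c == ord_max) < mu (ordS c))%N.
Proof. by rewrite /nu; lia. Qed.

Lemma admissible_rotate g : admissible mu g -> admissible nu (rotate_filling g).
Proof.
move=> ag; have g0 := admissible00 ag; case: ag => h1 h2.
split=> [d c dc|c k d l]; rewrite !nu_bound.
  have dn : (d == ord_max) = false.
    by rewrite -val_eqE /=; have := ltn_ord c; lia.
  rewrite /rotate_filling dn add0n => d0.
  rewrite (can2_eq (@ord_predK _) (@ordSK _)).
  have [->|cn] := eqVneq c ord_max.
    have -> : ordS (@ord_max n) = ord0 by apply/eqP; rewrite ordS_eq0.
    rewrite -[X in _ != X]g0 eq_sym; apply: h2 => //.
    by rewrite /precedes val_ordS dn.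
  by apply: h1 => //; rewrite !val_ordS dn (negPf cn).
move=> kc ld p; rewrite /rotate_filling (inj_eq (@ord_pred_inj _)).
by apply: h2 => //; rewrite precedes_ordS.
Qed.

Lemma entry_content_rotate g : admissible mu g ->
  entry_content nu (rotate_filling g) = rotate (entry_content mu g).
Proof.
move=> /admissible00 g0; apply/rowP => a; rewrite !mxE.
rewrite [X in _ = X - _](reindex_inj (@ordS_inj _)) /=.
apply/eqP; rewrite eq_sym subr_eq.
have -> : (a == ord_max)%:Z = \sum_(c : 'I_n.+1) ((c == ord_max) && (a == ord_max))%:Z.
  by rewrite (bigD1 ord_max) //= eqxx big1 ?addr0 // => c /negPf ->.
rewrite -big_split; apply/eqP; apply: eq_bigr => c _ /=.
have rE k : (rotate_filling g c k == a) = (g (ordS c) (k + (c == ord_max))%N == ordS a).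
  by rewrite /rotate_filling (can2_eq (@ord_predK _) (@ordSK _)).
rewrite (eq_bigr (fun k : 'I_(nu c) =>
    (g (ordS c) (k + (c == ord_max))%N == ordS a)%:Z)); last first.
  by move=> k _; rewrite rE.
rewrite /nu; case: (eqVneq c ord_max) => [->|_] /=; last first.
  by rewrite subn0 addr0; apply: eq_bigr => k _; rewrite addn0.
have -> : ordS (@ord_max n) = ord0 by apply/eqP; rewrite ordS_eq0.
case: (mu ord0) mu0 => // m _; rewrite big_ord_recl subn1 /= addrC g0 eq_sym ordS_eq0.
by congr (_ + _); apply: eq_bigr => k _; rewrite addn1.
Qed.

Lemma unrotateK h c k : (rotate_filling (unrotate_filling h) c k) = h c k.
Proof.
rewrite /rotate_filling /unrotate_filling ordS_eq0 addnK ordSK.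
by case: eqP => //= _; rewrite ?addn1 ?ordSK.
Qed.

Lemma admissible_unrotate h : admissible nu h -> admissible mu (unrotate_filling h).
Proof.
move=> [h1 h2].
have nuP c k : ((c == ord0) && (k == 0%N)) = false -> (k < mu c)%N ->
    (k - (c == ord0) < nu (ord_pred c))%N.
  rewrite /nu ord_predK -ordS_eq0 ord_predK; case: (c == ord0) => /=; lia.
split=> [d c dc d0|c k d l kc ld p].
  have c0 : (c == ord0) = false by rewrite -val_eqE /=; lia.
  rewrite /unrotate_filling eqxx andbT; have [_|dn0] := eqVneq d ord0; first by rewrite eq_sym c0.
  rewrite (can2_eq (@ordSK _) (@ord_predK _)); apply: h1.
    have := val_ordS (ord_pred d); have := val_ordS (ord_pred c).
    by rewrite !ord_predK -!ordS_eq0 !ord_predK c0 (negPf dn0); lia.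
  by have := nuP d 0%N; rewrite (negPf dn0); apply.
have dl : (d == ord0) && (l == 0%N) = false.
  by move: p; rewrite /precedes -val_eqE /=; lia.
rewrite /unrotate_filling dl.
have [/andP[/eqP c0 /eqP k0]|] := boolP ((c == ord0) && (k == 0%N)).
  have l0 : l = 0%N by move: p; rewrite /precedes c0 k0 /=; lia.
  have d0 : (d == ord0) = false by move: dl; rewrite l0 eqxx andbT.
  rewrite eq_sym ordS_eq0 d0 subn0 l0; apply: h1.
    have := val_ordS (ord_pred d); rewrite -ordS_eq0 ord_predK d0 /=.
    by have := ltn_ord d; lia.
  by have := nuP _ _ dl ld; rewrite l0 d0.
move=> /negbTE ck; rewrite (inj_eq (@ordS_inj _)); apply: h2; try exact: nuP.
have sub e m : (e == ord0) && (m == 0%N) = false -> ((e == @ord0 n) <= m)%N.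
  by case: (e == ord0) => //=; case: m.
by rewrite -precedes_ordS !ord_predK -!ordS_eq0 !ord_predK !subnK ?sub.
Qed.

Lemma rotate_inj : injective (@rotate n).
Proof.
move=> a b /rowP e; apply/rowP => i; have := e (ord_pred i).
by rewrite !mxE ord_predK => /addIr.
Qed.

Lemma contents_rotate : contents mu = [set a | contents nu (rotate a)]%classic.
Proof.
apply/seteqP; split=> a /=.
  move=> [g ag ->]; exists (rotate_filling g); first exact: admissible_rotate.
  by rewrite entry_content_rotate.
move=> [h ah e]; have ag := admissible_unrotate ah.
exists (unrotate_filling h) => //; apply: rotate_inj.
by rewrite e -entry_content_rotate //; apply: eq_entry_content => c k _; rewrite unrotateK.
Qed.

End Rotation.

Section WeightsBase.

Lemma contents0 n (mu : 'I_n -> nat) : (forall i, mu i = 0%N) ->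
  contents mu = [set 0]%classic.
Proof.
move=> mu0.
have w0 g : entry_content mu g = 0.
  apply/rowP => a; rewrite !mxE big1 // => i _; rewrite big1 // => -[k ki].
  by exfalso; rewrite mu0 in ki.
apply/seteqP; split=> a /= => [[g _ ->]|->]; first exact: w0.
by exists (fun i _ => i); rewrite ?w0 //; split=> [d c|i k j l]; rewrite mu0.
Qed.

Lemma contents_base_set n (mu : 'I_n.+1 -> nat) :
  base_set (contents mu) /\ reflection_closed (contents mu).
Proof.
have [N] : exists N, (\sum_i mu i = N)%N by exists (\sum_i mu i)%N.
elim: N mu => [|N IHN] mu sN.
  rewrite contents0; last first.
    by move=> i; move/eqP: sN; rewrite sum_nat_eq0 => /forallP/(_ i)/eqP.
  split; last by move=> i j a _ ->; rewrite !mxE ltxx.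
  exists (fun=> 0); split=> [A B //||A]; last first.
    by exists 0 => //; rewrite /mass big1 // => i _; rewrite mxE.
  apply/seteqP; split=> a /= => [->|[h1 h2]].
    by split=> [A|]; rewrite /mass big1 // => i _; rewrite mxE.
  apply/rowP => i; rewrite mxE.
  have := massU a [set i]%SET (~: [set i]%SET); have := h1 (~: [set i]%SET).
  have := h1 [set i]%SET.
  by rewrite setUCr setICr h2 /mass big_set1 big_set0; lia.
have [c0 mu0] : exists c, (0 < mu c)%N.
  have [/existsP//|] := boolP [exists c, (0 < mu c)%N].
  rewrite negb_exists => /forallP h; move: sN; rewrite big1 // => c _.
  by apply/eqP; rewrite -leqn0 leqNgt.
have [p ep] : exists p : nat, c0 = p :> nat by exists c0.
elim: p mu sN c0 mu0 ep => [|p IHp] mu sN c muc ec.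
  have ec0 : c = ord0 by apply: val_inj.
  rewrite ec0 in muc.
  have [bS rS] : base_set (contents (fun c => mu (ordS c) - (c == ord_max))%N) /\
      reflection_closed (contents (fun c => mu (ordS c) - (c == ord_max))%N).
    apply: IHN; apply: succn_inj; rewrite -sN [RHS](reindex_inj (@ordS_inj _)) /=.
    rewrite [RHS](bigD1 ord_max) // [X in X.+1](bigD1 ord_max) // eqxx /=.
    have -> : ordS (@ord_max n) = ord0 by apply/eqP; rewrite ordS_eq0.
    rewrite -addSn subn1 prednK //; congr addn.
    by apply: eq_bigr => d /negPf ->; rewrite subn0.
  rewrite contents_rotate //; split; first exact: base_set_rotate.
  exact: reflection_closed_rotate.
have pn : (p < n.+1)%N by have := ltn_ord c; lia.
pose q := Ordinal pn.
have [muq|] := posnP (mu q); last by move=> muq; apply: (IHp mu sN q).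
have [bS rS] : base_set (contents (fun k => mu (tperm q c k))) /\
    reflection_closed (contents (fun k => mu (tperm q c k))).
  apply: (IHp _ _ q) => //; last by rewrite tpermL.
  by rewrite -sN [RHS](reindex_inj (@perm_inj _ (tperm q c))).
rewrite (contents_empty_column (i := q) (j := c)) //.
have qc : (q < c)%N by rewrite ec /=.
split; last exact: reflection_closed_swap_union.
apply: base_set_swap_union => // [|a Sa|a Sa].
- by rewrite -val_eqE /= ec; lia.
- exact: (rS _ _ _ qc Sa).1.
- exact: (rS _ _ _ qc Sa).2.
Qed.

End WeightsBase.

Section Support.
Variable F : fieldType.

Lemma supp_monomial_mul n (a : 'rV[int]_n) (f : laurent F n) :
  supp (monomial_mul a f) = [set b | supp f (b - a)]%classic.
Proof.
apply/seteqP; suff e b : (monomial_mul a f)@_b = f@_(b - a).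
  by split=> b; rewrite /supp /= e.
rewrite /monomial_mul raddf_sum /=.
under eq_bigr do rewrite mcoeffU.
have [ba|ba] := boolP (b - a \in msupp f).
  rewrite (bigD1_seq (b - a)) ?fset_uniq //= addrCA subrr addr0 eqxx big1 ?addr0 //.
  move=> c cb; case: eqP => // e; case/eqP: cb.
  by rewrite -e addrC addKr.
rewrite (mcoeff_outdom ba) big1_seq // => c /andP[_ cf].
by case: eqP => // e; case/negP: ba; rewrite -e addrC addKr.
Qed.

Variable pos : F -> Prop.
Hypothesis posD : forall x y, pos x -> pos y -> pos (x + y).
Hypothesis pos0 : ~ pos 0.

Lemma supp_sum_pos n (I : finType) (P : pred I) (w : I -> F) (e : I -> 'rV[int]_n) :
  (forall i, pos (w i)) ->
  supp (\sum_(i | P i) << w i *g e i >>) = [set a | exists2 i, P i & a = e i]%classic.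
Proof.
move=> pw; apply/seteqP; split=> a; rewrite /supp /= raddf_sum /=.
  under eq_bigr do rewrite mcoeffU.
  have [/exists_inP[i Pi /eqP <-]|] := boolP [exists i in P, e i == a]; first by exists i.
  rewrite negb_exists_in => /forall_inP h; rewrite big1 ?eqxx // => i Pi.
  by rewrite (negPf (h i Pi)).
move=> [i Pi ->]; under eq_bigr do rewrite mcoeffU.
rewrite (bigD1 i) //= eqxx mulr1n; apply/eqP => s0; apply: pos0; rewrite -s0.
elim/big_rec: _ => [|j x _ hx]; first by rewrite addr0.
by rewrite addrCA; case: (_ == _); rewrite ?mulr1n ?mulr0n ?add0r //; apply: posD.
Qed.

Variables q t : F.
Hypothesis posM : forall x y, pos x -> pos y -> pos (x * y).
Hypothesis posV : forall x, pos x -> pos x^-1.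
Hypothesis pos1 : pos 1.
Hypotheses (posq : pos q) (post : pos t) (pos1t : pos (1 - t)).
Hypothesis pos1qt : forall a b, pos (1 - q ^+ a.+1 * t ^+ b.+1).

Lemma weight_pos n (mu : 'I_n -> nat) (s : filling mu) : pos (weight q t s).
Proof.
have posX x k : pos x -> pos (x ^+ k).
  by move=> px; elim: k => [|k IHk]; rewrite ?expr0 // exprS; apply: posM.
rewrite /weight; apply: posM; first apply: posM; first exact: posX.
  by case: (coinv s) => k; rewrite ?NegzE -?exprnN -?exprnP; [|apply: posV]; apply: posX.
by elim/big_ind: _ => // u _; apply: posM => //; apply: posV.
Qed.

Lemma supp_macdonald_base_set n (mu : 'rV[int]_n.+1) m :
  base_set (supp (macdonald q t mu m)).
Proof.
rewrite /macdonald supp_monomial_mul /macdonald_nonneg.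
rewrite supp_sum_pos => [|s]; last exact: weight_pos.
rewrite contentsE; have [bS _] := contents_base_set (fun i => `|(mu 0 i - m)%R|%N).
have := base_set_affine 1%g (- const_mx m) bS.
by congr base_set; apply/seteqP; split=> a /=; rewrite col_perm1.
Qed.

Lemma macdonald_M_convex_saturated (R : realType) n (mu : 'rV[int]_n.+1) m :
  M_convex R (supp (macdonald q t mu m)) /\
  saturated_newton_polytope R (macdonald q t mu m).
Proof.
have bS := supp_macdonald_base_set mu m.
split; last exact: base_set_saturated.
apply: (@base_set_M_convex _ _ _ (enum_fset (msupp (macdonald q t mu m)))) => //.
by apply/seteqP; split=> a /=; rewrite -[a \in _]/(a \in msupp _) -mcoeff_neq0.
Qed.

End Support.

Section RationalFunctions.

Definition half_eval (p : {poly {poly rat}}) : rat := p.[(2^-1)%:P].[2^-1].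

(* Positivity at q = t = 1/2 is closed under the field operations, so no
   cancellation can occur between the weights of different fillings. *)
Definition half_pos (x : Qqt) : Prop :=
  exists p d, [/\ x = tofrac p / tofrac d, 0 < half_eval p & 0 < half_eval d].

Lemma half_evalD p d : half_eval (p + d) = half_eval p + half_eval d.
Proof. by rewrite /half_eval !hornerD. Qed.

Lemma half_evalM p d : half_eval (p * d) = half_eval p * half_eval d.
Proof. by rewrite /half_eval !hornerM. Qed.

Lemma half_eval1 : half_eval 1 = 1.
Proof. by rewrite /half_eval !hornerE. Qed.

Lemma tofrac_neq0 p : 0 < half_eval p -> tofrac p != 0.
Proof.
by move=> p0; rewrite tofrac_eq0; apply: contraTneq p0 => ->; rewrite /half_eval !hornerE.
Qed.

Lemma half_posD x y : half_pos x -> half_pos y -> half_pos (x + y).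
Proof.
move=> [p [d [-> p0 d0]]] [p' [d' [-> p'0 d'0]]].
exists (p * d' + p' * d), (d * d'); split.
- by rewrite addf_div ?tofrac_neq0 // !rmorphM rmorphD !rmorphM.
- by rewrite half_evalD !half_evalM addr_gt0 ?mulr_gt0.
- by rewrite half_evalM mulr_gt0.
Qed.

Lemma half_posM x y : half_pos x -> half_pos y -> half_pos (x * y).
Proof.
move=> [p [d [-> p0 d0]]] [p' [d' [-> p'0 d'0]]].
exists (p * p'), (d * d'); split; try by rewrite half_evalM mulr_gt0.
by rewrite mulf_div !rmorphM.
Qed.

Lemma half_posV x : half_pos x -> half_pos x^-1.
Proof. by move=> [p [d [-> p0 d0]]]; exists d, p; split=> //; rewrite invf_div. Qed.

Lemma half_pos0 : ~ half_pos 0.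
Proof.
move=> [p [d [/esym/eqP e p0 d0]]]; move: e.
by rewrite mulf_eq0 invr_eq0 !(negPf (tofrac_neq0 _)).
Qed.

Lemma half_pos_tofrac p : 0 < half_eval p -> half_pos (tofrac p).
Proof. by move=> p0; exists p, 1; rewrite half_eval1 rmorph1 divr1. Qed.

Lemma half_pos1qt a b : half_pos (1 - q_ind ^+ a * t_ind ^+ b.+1).
Proof.
rewrite /q_ind /t_ind -!rmorphXn -rmorphM -(rmorph1 (@tofrac _)) -rmorphB.
apply: half_pos_tofrac; rewrite /half_eval !hornerE -exprD subr_gt0.
by rewrite exprn_ilt1 // addnS.
Qed.

End RationalFunctions.

Theorem theorem1p1 (R : realType) (n : nat) (mu : 'rV[int]_n) (m : int) :
  (1 <= n)%N ->
  (forall i : 'I_n, m <= mu 0 i) ->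
  (M_convex R (supp (macdonald q_ind t_ind mu m))
   /\ saturated_newton_polytope R (macdonald q_ind t_ind mu m))
  /\
  (forall q t : R, 0 < q < 1 -> 0 < t < 1 ->
     M_convex R (supp (macdonald q t mu m))
     /\ saturated_newton_polytope R (macdonald q t mu m)).
Proof.
case: n mu => // n mu _ _; split=> [|q t /andP[q0 q1] /andP[t0 t1]].
  apply: (@macdonald_M_convex_saturated _ half_pos half_posD half_pos0
    _ _ half_posM half_posV).
  - by have := half_pos_tofrac (p := 1); rewrite half_eval1 rmorph1; apply.
  - by apply: half_pos_tofrac; rewrite /half_eval !hornerE.
  - by apply: half_pos_tofrac; rewrite /half_eval !hornerE.
  - by have := half_pos1qt 0 0; rewrite expr0 mul1r.
  - by move=> a b; exact: half_pos1qt.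
apply: (@macdonald_M_convex_saturated _ (fun x : R => 0 < x)) => //.
- exact: addr_gt0.
- by rewrite ltxx.
- exact: mulr_gt0.
- by move=> x; rewrite invr_gt0.
- by rewrite subr_gt0.
- by move=> a b; rewrite subr_gt0 mulr_ilt1 ?exprn_ilt1 ?exprn_ge0 // ltW.
Qed.
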